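(* For any $P,N>0$ with $\frac NP\le\frac{L-1}{L}$ and any $L\in\mathbb{Z}_{\ge2}$, $$\overline{C}_{L-1}(P,N)\ge\frac12\left(\ln\frac{(L-1)P}{LN}+\frac{LN}{(L-1)P}-1\right).$$
   Context: $\mathcal{B}^n(r)$ is the closed Euclidean ball of radius $r$ centered at the origin. For $x_1,\dots,x_L\in\mathbb{R}^n$ with centroid $\bar x=\frac1L\sum_ix_i$, $\overline{\mathrm{rad}}^2(x_1,\dots,x_L)=\frac1L\sum_i\|x_i-\bar x\|_2^2$. A finite $\mathcal{C}\subseteq\mathcal{B}^n(\sqrt{nP})$ is $(P,N,L-1)$-average-radius list-decodable if every $L$ distinct points of $\mathcal{C}$ have $\overline{\mathrm{rad}}^2>nN$. Rate $R(\mathcal{C})=\frac1n\ln|\mathcal{C}|$. $\overline{C}_{L-1}(P,N)=\limsup_{n\to\infty}\sup R(\mathcal{C})$ over such codes in $\mathcal{B}^n(\sqrt{nP})$. *)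

(* Defs.v *)
From HB Require Import structures.
From mathcomp Require Import all_boot all_order all_algebra.
From mathcomp Require Import all_classical all_reals all_analysis.
Set Implicit Arguments. Unset Strict Implicit. Unset Printing Implicit Defensive.
Import Order.TTheory GRing.Theory Num.Theory.
Local Open Scope ring_scope.
Local Open Scope classical_set_scope.

Section Defs.
Variable R : realType.

Definition sqnorm (n : nat) (x : 'rV[R]_n) : R := \sum_(i < n) x 0 i ^+ 2.

Definition in_ball (n : nat) (r : R) (x : 'rV[R]_n) : Prop :=
  Num.sqrt (sqnorm x) <= r.

Definition centroid (n L : nat) (x : 'I_L -> 'rV[R]_n) : 'rV[R]_n :=
  (L%:R)^-1 *: \sum_(i < L) x i.

Definition avg_rad2 (n L : nat) (x : 'I_L -> 'rV[R]_n) : R :=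
  (L%:R)^-1 * \sum_(i < L) sqnorm (x i - centroid x).

(* C (duplicate-free list of codewords) is a (P,N,k)-average-radius
   list-decodable code in B^n(sqrt(nP)), with k = L-1, i.e. L = k+1 *)
Definition avg_rad_list_decodable (n k : nat) (P N : R) (C : seq 'rV[R]_n) : Prop :=
  uniq C /\
  (forall x, x \in C -> in_ball (Num.sqrt (n%:R * P)) x) /\
  (forall f : 'I_k.+1 -> 'rV[R]_n, injective f -> (forall i, f i \in C) ->
     n%:R * N < avg_rad2 f).

Definition rate (n : nat) (C : seq 'rV[R]_n) : R := ln (size C)%:R / n%:R.

Definition list_capacity (k : nat) (P N : R) : \bar R :=
  limn_esup (fun n : nat =>
    ereal_sup [set ((rate C)%:E)%E | C in [set C : seq 'rV[R]_n |
                                           avg_rad_list_decodable k P N C]]).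
End Defs.

(* Main.v *)
Require Import Defs.
From HB Require Import structures.
From mathcomp Require Import all_boot all_order all_algebra.
From mathcomp Require Import all_classical all_reals all_analysis.
From mathcomp Require Import ring lra.
Set Implicit Arguments. Unset Strict Implicit. Unset Printing Implicit Defensive.
Import Order.TTheory GRing.Theory Num.Theory.
Import numFieldNormedType.Exports.
Local Open Scope classical_set_scope.
Local Open Scope ring_scope.

(** Random coding with expurgation.  If the L = k + 1 codewords of a tuple have
    i.i.d. Gaussian letters of variance s2, then L avg_rad2 / s2 is a chi-square
    variable with (L - 1) n degrees of freedom, and Chernoff's bound at the
    optimal parameter says that avg_rad2 <= n N has probability about
    exp (- n (L - 1) E), E being the claimed exponent.  Hence a random code of
    size about exp (n E) contains few bad L-tuples, and deleting one codeword
    from each of them costs nothing in rate.  The power constraint needs only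
    Markov's inequality: for s2 < P a constant fraction of the codewords
    satisfies it, and a constant factor in the size is free.  A codeword
    repeated L times is a bad tuple, so after the deletions multiplicities are
    at most L - 1.

    To keep all probabilities finite sums, the Gaussian law is replaced by
    Gaussian weights on a fine truncated grid.  The bounds on such sums depend
    on the integral of exp (- x ^ 2), whose value cancels by normalization. *)

(** * Gaussian sums *)

Definition gauss_area (R : realType) (x : R) : R :=
  (\int[lebesgue_measure]_(t in `[0, x]) gauss_fun t)%R.

(** [gauss_fun] decreases on the nonnegative half-line, so on [a, b] it lies between its endpoint
    values. *)
Lemma gauss_area_bounds (R : realType) (a b : R) : 0 <= a -> a <= b ->
  (b - a) * gauss_fun b <= gauss_area b - gauss_area a <= (b - a) * gauss_fun a.
Proof.
move=> a0 ab.
have int (i : interval R) :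
    lebesgue_measure.-integrable [set` i] (EFin \o @gauss_fun R).
  apply: (@integrableS _ _ _ _ setT) => //; exact: integrableT_gauss.
have cint r : (@lebesgue_measure R).-integrable `]a, b] (EFin \o cst r).
  suff: (@lebesgue_measure R).-integrable `[a, b] (EFin \o cst r).
    by apply: integrableS => //; exact: subset_itv_oc_cc.
  apply: continuous_compact_integrable; first exact: segment_compact.
  by apply: continuous_subspaceT; exact: cst_continuous.
have cI r : (\int[lebesgue_measure]_(t in `]a, b]) (cst r t))%R = (b - a) * r.
  rewrite Rintegral_cst// mulrC; congr (_ * _).
  apply: (etrans (congr1 fine (lebesgue_measure_itv `]a, b]))) => /=.
  by rewrite lte_fin; case: ltgtP ab => // ->; rewrite subrr.
rewrite /gauss_area Rintegral_itvB ?bnd_simp//.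
by rewrite -!cI; apply/andP; split; apply: le_Rintegral => // x;
  rewrite /= in_itv/= => /andP[ax xb];
  rewrite ler_expR lerN2 ler_sqr ?nnegrE//; lra.
Qed.

Lemma gauss_area0 (R : realType) : gauss_area (0 : R) = 0.
Proof. by rewrite /gauss_area set_itv1 Rintegral_set1. Qed.

Lemma gauss_area_ub (R : realType) (x : R) :
  gauss_area x <= (\int[lebesgue_measure]_t gauss_fun t)%R.
Proof.
have iT := @integrableT_gauss R.
rewrite /gauss_area /Rintegral fine_le//.
- apply: integrable_fin_num => //; exact: integrableS iT.
- exact: integrable_fin_num.
apply: ge0_subset_integral => //.
- exact: measurable_int iT.
- by move=> t _; rewrite lee_fin gauss_fun_ge0.
Qed.

(** H is the integral of exp (- t ^ 2) over the half-line, taken as a supremum; its approximation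
    property yields the cutoff point of the grid. *)
Lemma gauss_area_sup (R : realType) : exists H : R, 0 < H /\
  (forall x : R, 0 <= x -> gauss_area x <= H) /\
  (forall e : R, 0 < e -> exists2 x : R, 0 <= x & H - e < gauss_area x).
Proof.
pose S := [set gauss_area x | x in [set x : R | 0 <= x]].
have S0 : S !=set0 by exists (gauss_area 0); exists 0 => /=.
have hS : has_sup S.
  split=> //; exists (\int[lebesgue_measure]_t gauss_fun t)%R.
  by move=> _ [x _ <-]; exact: gauss_area_ub.
have ubH x : 0 <= x -> gauss_area x <= sup S.
  by move=> x0; apply: sup_upper_bound => //; exists x.
exists (sup S); split; last split => //.
- apply: lt_le_trans (ubH 1 ler01).
  have /andP[+ _] := @gauss_area_bounds R 0 1 (lexx _) ler01.
  rewrite gauss_area0 !subr0 mul1r; apply: lt_le_trans; exact: expR_gt0.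
- move=> e e0; have [_ [x /= x0 <-] xe] := sup_adherent e0 hS.
  by exists x.
Qed.

(** The first term is at most 1; every later term times d is at most the area over the cell to its
    left, and these areas telescope. *)
Lemma gauss_sum_half_ub (R : realType) (H d o : R) (n : nat) :
  (forall x, 0 <= x -> gauss_area x <= H) -> 0 < d -> 0 <= o ->
  \sum_(j < n) gauss_fun (o + d * j%:R) <= 1 + H / d.
Proof.
move=> HH d0 o0.
have H0 : 0 <= H by rewrite -(gauss_area0 R); apply: HH.
case: n => [|n]; first by rewrite big_ord0 addr_ge0// divr_ge0// ltW.
rewrite big_ord_recl /= mulr0 addr0 lerD ?gauss_fun_le1// ler_pdivlMr//.
have step : (\sum_(j < n) gauss_fun (o + d * j.+1%:R)) * d
    <= gauss_area (o + d * n%:R) - gauss_area o.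
  elim: n => [|n IH]; first by rewrite big_ord0 mul0r mulr0 addr0 subrr.
  rewrite big_ord_recr /= mulrDl.
  have on : 0 <= o + d * n%:R by rewrite addr_ge0// mulr_ge0// ltW.
  have le_on : o + d * n%:R <= o + d * n.+1%:R.
    by rewrite lerD2l ler_pM2l// ler_nat.
  have /andP[+ _] := gauss_area_bounds on le_on.
  rewrite (_ : o + d * n.+1%:R - _ = d); last by rewrite -natr1; ring.
  rewrite [d * _]mulrC; move: IH; lra.
apply: le_trans step _.
have on : 0 <= o + d * n%:R by rewrite addr_ge0// mulr_ge0// ltW.
have := HH _ on.
have /andP[+ _] := gauss_area_bounds (lexx _) o0.
have := mulr_ge0 o0 (gauss_fun_ge0 o).
rewrite gauss_area0 !subr0; lra.
Qed.

(** The bound is uniform in the centre m, since completing the square moves it. On either side of m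
    the terms decrease away from it, so the one-sided bound applies twice. *)
Lemma gauss_sum_ub (R : realType) (H d m : R) (n : nat) :
  (forall x, 0 <= x -> gauss_area x <= H) -> 0 < d ->
  \sum_(i < n) gauss_fun (d * (i%:R - m)) <= 2 + H *+ 2 / d.
Proof.
move=> HH d0.
have H0 : 0 <= H by rewrite -(gauss_area0 R); apply: HH.
have [p lo hi] : exists2 p : nat,
    (0 < p)%N -> p.-1%:R <= m & m <= p%:R.
  have [m0|m0] := ltP m 0; first by exists 0%N => //; exact: ltW.
  exists (Num.truncn m).+1 => [_ /=|]; first by rewrite truncn_le.
  exact/ltW/truncnS_gt.
(* Padding to p + n terms allows the split at p even when p > n. *)
apply: (@le_trans _ _ (\sum_(i < p + n) gauss_fun (d * (i%:R - m)))).
  by rewrite addnC big_split_ord /= lerDl sumr_ge0// => i _; exact: gauss_fun_ge0.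
rewrite big_split_ord /= (_ : 2 + _ = (1 + H / d) + (1 + H / d)); last first.
  by rewrite mulr2n; ring.
apply: lerD.
  rewrite (reindex_inj rev_ord_inj) /=.
  case: p lo {hi} => [_|p /(_ isT) /= lo].
    by rewrite big_ord0 addr_ge0// divr_ge0// ltW.
  rewrite (eq_bigr (fun i : 'I_p.+1 => gauss_fun (d * (m - p%:R) + d * i%:R))).
    by apply: gauss_sum_half_ub => //; rewrite mulr_ge0 ?subr_ge0// ltW.
  have ip (i : 'I_p.+1) : (i <= p)%N by rewrite -ltnS.
  move=> i _; rewrite subSS natrB// /gauss_fun -sqrrN.
  by congr (expR (- _ ^+ 2)); ring.
rewrite (eq_bigr (fun i : 'I_n => gauss_fun (d * (p%:R - m) + d * i%:R))).
  by apply: gauss_sum_half_ub => //; rewrite mulr_ge0 ?subr_ge0// ltW.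
by move=> i _; rewrite natrD; congr (gauss_fun _); ring.
Qed.

Lemma gauss_sum_half_lb (R : realType) (d : R) (n : nat) : 0 < d ->
  gauss_area (d * n%:R) / d <= \sum_(j < n) gauss_fun (d * j%:R).
Proof.
move=> d0; rewrite ler_pdivrMr//.
elim: n => [|n IH]; first by rewrite big_ord0 mul0r mulr0 gauss_area0.
rewrite big_ord_recr /= mulrDl.
have on : 0 <= d * n%:R by rewrite mulr_ge0// ltW.
have le_on : d * n%:R <= d * n.+1%:R by rewrite ler_pM2l// ler_nat.
have /andP[_ +] := gauss_area_bounds on le_on.
rewrite (_ : d * n.+1%:R - _ = d); last by rewrite -natr1; ring.
rewrite [d * _]mulrC; move: IH; lra.
Qed.

(** The centre is counted by both one-sided sums, hence the correction - 1. *)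
Lemma gauss_sum_lb (R : realType) (d : R) (K : nat) : 0 < d ->
  gauss_area (d * K.+1%:R) *+ 2 / d - 1
    <= \sum_(i < K + K.+1) gauss_fun (d * (i%:R - K%:R)).
Proof.
move=> d0; rewrite big_split_ord /=.
rewrite [X in _ <= _ + X](eq_bigr (fun i : 'I_K.+1 => gauss_fun (d * i%:R))).
  rewrite (reindex_inj rev_ord_inj) /=.
  rewrite [X in _ <= X + _](eq_bigr (fun i : 'I_K => gauss_fun (d * i.+1%:R))).
    have g0 : gauss_fun (0 : R) = 1 by rewrite /gauss_fun expr0n oppr0 expR0.
    have := gauss_sum_half_lb K.+1 d0.
    rewrite big_ord_recl /= mulr0 g0.
    rewrite mulr2n mulrDl; lra.
  move=> i _; rewrite natrB// /gauss_fun -sqrrN.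
  by congr (expR (- _ ^+ 2)); ring.
by move=> i _; rewrite natrD; congr (gauss_fun _); ring.
Qed.

(** J is the integral of exp (- x ^ 2) over the whole line, and sqrt r is the mesh of a Riemann sum
    for it. *)
Lemma discrete_gauss_asymp (R : realType) : exists2 J : R, 0 < J &
  forall e : R, 0 < e -> exists2 r0 : R, 0 < r0 & forall r : R, 0 < r -> r <= r0 ->
    (forall m n, \sum_(i < n) expR (- (r * (i%:R - m) ^+ 2))
      <= (1 + e) * J / Num.sqrt r) /\
    (exists K, (1 - e) * J / Num.sqrt r
      <= \sum_(i < K + K.+1) expR (- (r * (i%:R - K%:R) ^+ 2))).
Proof.
have [H [H0 [HH HS]]] := gauss_area_sup R.
exists (H *+ 2); first by rewrite pmulrn_rgt0.
(* This threshold gives sqrt r <= e H, which absorbs the additive errors 2 and 1 of the sum bounds.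
   In the lower bound the remaining slack pays for cutting the tail. *)
move=> e e0; exists ((e * H) ^+ 2); first by rewrite exprn_gt0// mulr_gt0.
move=> r r0 re.
have d0 : 0 < Num.sqrt r by rewrite sqrtr_gt0.
have dle : Num.sqrt r <= e * H.
  rewrite -(ler_pXn2r (_ : 0 < 2)%N) ?nnegrE ?sqrtr_ge0//.
    by rewrite sqr_sqrtr// ltW.
  by rewrite ltW// mulr_gt0.
have gE m (i : nat) : expR (- (r * (i%:R - m) ^+ 2))
    = gauss_fun (Num.sqrt r * (i%:R - m)).
  by rewrite /gauss_fun exprMn sqr_sqrtr// ltW.
split=> [m n|].
  rewrite (eq_bigr _ (fun i _ => gE m (val i))).
  apply: le_trans (gauss_sum_ub m n HH d0) _.
  rewrite -subr_ge0 (_ : _ - _ = (e * H - Num.sqrt r) * 2 / Num.sqrt r).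
    by apply: divr_ge0 (ltW d0); rewrite mulr_ge0// subr_ge0.
  by rewrite -mulr_natr; field; rewrite gt_eqF.
have eH0 : 0 < e * H / 2 by rewrite divr_gt0// mulr_gt0.
have [x x0 xH] := HS _ eH0.
pose K := Num.truncn (x / Num.sqrt r); exists K.
rewrite (eq_bigr _ (fun i _ => gE K%:R (val i))).
apply: le_trans (gauss_sum_lb K d0).
have xK : x <= Num.sqrt r * K.+1%:R.
  by rewrite mulrC -ler_pdivrMr// ltW// truncnS_gt.
have aK : gauss_area x <= gauss_area (Num.sqrt r * K.+1%:R).
  rewrite -subr_ge0; have /andP[+ _] := gauss_area_bounds x0 xK.
  by apply: le_trans; rewrite mulr_ge0 ?gauss_fun_ge0// subr_ge0.
rewrite lerBrDr ler_pdivlMr// mulrDl mul1r divfK ?gt_eqF//.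
move: aK xH dle; rewrite (mulr2n H) (mulr2n (gauss_area _)); lra.
Qed.

(** * Gaussian sums of quadratic forms in several variables *)

Definition ffun_cons (A : Type) (m : nat) (a : A) (u : {ffun 'I_m -> A}) :
    {ffun 'I_m.+1 -> A} :=
  [ffun i => if unlift ord0 i is Some j then u j else a].

Lemma ffun_cons0 (A : Type) (m : nat) (a : A) (u : {ffun 'I_m -> A}) :
  ffun_cons a u ord0 = a.
Proof. by rewrite ffunE unlift_none. Qed.

Lemma ffun_consS (A : Type) (m : nat) (a : A) (u : {ffun 'I_m -> A}) i :
  ffun_cons a u (lift ord0 i) = u i.
Proof. by rewrite ffunE liftK. Qed.

Lemma sum_ffun_cons (V : nmodType) (A : finType) (m : nat)
    (G : {ffun 'I_m.+1 -> A} -> V) :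
  \sum_u G u = \sum_(u : {ffun 'I_m -> A}) \sum_a G (ffun_cons a u).
Proof.
rewrite pair_big /=.
rewrite (reindex (fun p : {ffun 'I_m -> A} * A => ffun_cons p.2 p.1)) //.
exists (fun u : {ffun 'I_m.+1 -> A} => ([ffun i => u (lift ord0 i)], u ord0)) => [[u a] _|u _] /=.
  rewrite ffun_cons0; congr (_, _).
  by apply/ffunP => i; rewrite ffunE ffun_consS.
apply/ffunP => i; have [j ->|->] := unliftP ord0 i.
  by rewrite ffun_consS ffunE.
by rewrite ffun_cons0.
Qed.

(* One variable is summed at a time: completing the square in it leaves a
   form of the same shape in the others, with b replaced by ab/(a - b). *)
Lemma gauss_form_sum (R : realType) (A : finType) (z : A -> R) (J r0 : R)
    (m : nat) (a b : R) :
  (forall r c, 0 < r -> r <= r0 ->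
    \sum_x expR (- (r * (z x - c) ^+ 2)) <= J / Num.sqrt r) ->
  0 <= J -> 0 < a -> a <= r0 -> 0 <= b -> m%:R * b < a ->
  \sum_(u : {ffun 'I_m -> A})
     expR (- (a * \sum_i z (u i) ^+ 2) + b * (\sum_i z (u i)) ^+ 2)
    <= J ^+ m / Num.sqrt (a ^+ m * (1 - m%:R * b / a)).
Proof.
move=> HJ J0 a0 ar; elim: m b => [|m IH] b b0 mb.
  rewrite (eq_bigr (fun=> 1)) => [|u _].
    rewrite sumr_const card_ffun card_ord expn0 !expr0 !mul0r subr0 mulr1.
    by rewrite sqrtr1 divr1.
  by rewrite !big_ord0 expr0n /= !mulr0 oppr0 addr0 expR0.
have ab0 : 0 < a - b.
  rewrite subr_gt0; apply: le_lt_trans mb.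
  by rewrite -natr1 mulrDl mul1r lerDr mulr_ge0.
have ab_neq0 : a - b != 0 by rewrite gt_eqF.
pose b' := a * b / (a - b).
have b'0 : 0 <= b' by rewrite divr_ge0 ?mulr_ge0// ltW.
have mb' : m%:R * b' < a.
  rewrite /b' mulrA ltr_pdivrMr// mulrCA ltr_pM2l// ltrBrDr.
  by move: mb; rewrite -natr1 mulrDl mul1r.
rewrite sum_ffun_cons.
apply: (@le_trans _ _ (\sum_(u : {ffun 'I_m -> A})
   expR (- (a * \sum_i z (u i) ^+ 2) + b' * (\sum_i z (u i)) ^+ 2)
     * (J / Num.sqrt (a - b)))).
  apply: ler_sum => u _.
  set S2 := \sum_i z (u i) ^+ 2; set S := \sum_i z (u i).
  have ab_le : a - b <= r0 by apply: le_trans ar; rewrite gerBl.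
  apply: le_trans (ler_wpM2l (expR_ge0 _) (HJ (a - b) (b * S / (a - b)) ab0 ab_le)).
  rewrite mulr_sumr; apply: ler_sum => x _.
  rewrite !big_ord_recl ffun_cons0.
  under eq_bigr do rewrite ffun_consS.
  under [X in b * (_ + X) ^+ 2]eq_bigr do rewrite ffun_consS.
  rewrite -/S2 -/S -expRD ler_expR le_eqVlt; apply/orP; left; apply/eqP.
  by rewrite /b'; field.
rewrite -mulr_suml.
apply: le_trans (ler_wpM2r _ (IH b' b'0 mb')) _.
  by rewrite divr_ge0// sqrtr_ge0.
have mb'1 : 0 <= a ^+ m * (1 - m%:R * b' / a).
  by rewrite mulr_ge0 ?exprn_ge0 ?(ltW a0)// subr_ge0 ler_pdivrMr// mul1r ltW.
rewrite mulf_div -exprSr -sqrtrM//.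
(* a ^ m (1 - m b / a) is the determinant of the form a |u| ^ 2 - b (sum u) ^ 2 in m variables;
   eliminating one variable splits off the pivot a - b. *)
rewrite (_ : a ^+ m * (1 - m%:R * b' / a) * (a - b)
           = a ^+ m.+1 * (1 - m.+1%:R * b / a))//.
rewrite exprSr /b' -natr1; field.
by rewrite ab_neq0 gt_eqF.
Qed.

(** From exp y >= 1 + y with y = r c z ^ 2: the second moment is controlled by Gaussian sums at the
    parameters r and r (1 - c), a discrete form of differentiating in r. *)
Lemma gauss_second_moment (R : realType) (A : finType) (z : A -> R) (r c : R) :
  r * c * (\sum_x expR (- (r * z x ^+ 2)) * z x ^+ 2)
    + \sum_x expR (- (r * z x ^+ 2))
  <= \sum_x expR (- (r * (1 - c) * z x ^+ 2)).
Proof.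
rewrite mulr_sumr -big_split /=; apply: ler_sum => x _.
rewrite (_ : _ + _ = expR (- (r * z x ^+ 2)) * (1 + r * c * z x ^+ 2)); last by ring.
rewrite (_ : - (r * (1 - c) * _) = - (r * z x ^+ 2) + r * c * z x ^+ 2); last by ring.
by rewrite expRD ler_wpM2l ?expR_ge0// expR_ge1Dx.
Qed.

(** * The alphabet *)

Lemma inv_sqrt1B_le (R : realType) (c : R) : 0 <= c -> c <= 2^-1 ->
  (Num.sqrt (1 - c))^-1 <= 1 + c / 2 + c ^+ 2.
Proof.
move=> c0 c1.
have d0 : 0 < 1 - c by lra.
have s0 : 0 < Num.sqrt (1 - c) by rewrite sqrtr_gt0.
have p0 : 0 < 1 + c / 2 + c ^+ 2 by nra.
rewrite -[leLHS]mul1r ler_pdivrMr// -(ler_pXn2r (_ : 0 < 2)%N) ?nnegrE//.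
  rewrite expr1n exprMn sqr_sqrtr ?(ltW d0)// -subr_ge0.
  rewrite (_ : _ - 1 = c ^+ 2 * (5%:R / 4%:R * (1 - c) - c ^+ 3)); last by field.
  rewrite mulr_ge0 ?sqr_ge0// subr_ge0.
  have : c ^+ 3 <= c * (1 - c).
    have : c ^+ 2 <= 1 - c by nra.
    by rewrite exprS => ?; rewrite ler_wpM2l.
  nra.
by rewrite mulr_ge0 ?ltW.
Qed.

(* The letters are the points of a fine grid with Gaussian weights of variance
   close to s2, cut off far from the origin. *)
Lemma gaussian_alphabet (R : realType) (s2 c l : R) (k : nat) :
  0 < s2 -> 0 < c -> c <= 2^-1 -> 0 <= l ->
  exists (A : finType) (w v : A -> R),
    [/\ forall x, 0 <= w x, \sum_x w x = 1,
        \sum_x w x * v x ^+ 2 <= s2 * (1 + 6%:R * c) &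
        \sum_(u : {ffun 'I_k.+1 -> A}) (\prod_j w (u j)) *
           expR (- (l / (2 * s2) *
             (\sum_j v (u j) ^+ 2 - (\sum_j v (u j)) ^+ 2 / k.+1%:R)))
        <= (1 + c ^+ 2) ^+ k.+1 / Num.sqrt ((1 + l) ^+ k)].
Proof.
move=> s20 c0 c1 l0.
have [J J0 HJ] := discrete_gauss_asymp R.
(* With this e the upper and lower bounds on Gaussian sums differ by a factor of at most 1 + c ^
   2. *)
pose e := c ^+ 2 / 4%:R.
have e0 : 0 < e by rewrite divr_gt0 ?exprn_gt0.
have e1 : 0 < 1 - e by rewrite /e; nra.
have ec : (1 + e) / (1 - e) <= 1 + c ^+ 2.
  rewrite ler_pdivrMr// (_ : c ^+ 2 = 4%:R * e); last by rewrite /e; field.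
  have : e <= 2^-1 by rewrite /e; nra.
  by nra.
have [r0 r00 Hr] := HJ e e0.
have l1 : 0 < 1 + l by rewrite ltr_pwDl.
(* The exponential factor raises the coefficient of the squares from al to al (1 + l), which is thus
   r0, the end of the admissible range. *)
pose al := r0 / (1 + l).
have al0 : 0 < al by rewrite divr_gt0.
have alr : al <= r0 by rewrite ler_pdivrMr// mulrDr mulr1 lerDl mulr_ge0// ltW.
have r0E : r0 = al * (1 + l) by rewrite /al divfK// gt_eqF.
clearbody e al.
have [_ [K HK]] := Hr al al0 alr.
pose A := 'I_(K + K.+1).
pose z (i : A) : R := i%:R - K%:R.
pose Z : R := \sum_i expR (- (al * z i ^+ 2)).
have sal0 : 0 < Num.sqrt al by rewrite sqrtr_gt0.
have ZlbP : (1 - e) * J / Num.sqrt al <= Z := HK.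
have lb0 : 0 < (1 - e) * J / Num.sqrt al by rewrite divr_gt0// mulr_gt0.
have Z0 : 0 < Z by exact: lt_le_trans ZlbP.
have Hz r x : 0 < r -> r <= r0 ->
    \sum_i expR (- (r * (z i - x) ^+ 2)) <= (1 + e) * J / Num.sqrt r.
  move=> r_0 r_r; have [/(_ (K%:R + x) (K + K.+1)%N) + _] := Hr r r_0 r_r.
  by apply: le_trans; apply: ler_sum => i _; rewrite /z opprD addrA.
pose w (i : A) := expR (- (al * z i ^+ 2)) / Z.
(* Scaling by h turns exp (- al z ^ 2) into exp (- v ^ 2 / (2 s2)), the Gaussian weight of variance
   s2. *)
pose h := Num.sqrt (2 * s2 * al).
have h2 : h ^+ 2 = 2 * s2 * al by rewrite sqr_sqrtr// ltW// !mulr_gt0.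
exists A, w, (fun i => h * z i); split.
- by move=> i; rewrite divr_ge0 ?expR_ge0 ?(ltW Z0).
- by rewrite -mulr_suml divff// gt_eqF.
- have := gauss_second_moment z al c.
  rewrite -/Z.
  set M := \sum_x _ * _ => HM.
  have -> : \sum_i w i * (h * z i) ^+ 2 = 2 * s2 * al * M / Z.
    rewrite /M mulr_sumr mulr_suml; apply: eq_bigr => i _.
    by rewrite /w exprMn h2; ring.
  have c_gt0 : 0 < 1 - c by lra.
  have alc0 : 0 < al * (1 - c) by rewrite mulr_gt0.
  have alcr : al * (1 - c) <= r0.
    by apply: le_trans alr; rewrite ger_pMr//; lra.
  have := Hz _ 0 alc0 alcr.
  under eq_bigr do rewrite subr0.
  move=> /(le_trans HM) {}HM.
  have sc0 : 0 < Num.sqrt (1 - c) by rewrite sqrtr_gt0.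
  (* Relative to Z the bound is 1 + c / 2 + O(c ^ 2); subtracting 1 and dividing by c leaves 1 / 2 +
     O(c), so the second moment is at most s2 (1 + O(c)). *)
  have ubE : (1 + e) * J / Num.sqrt (al * (1 - c)) <=
      (1 + c ^+ 2) * (1 + c / 2 + c ^+ 2) * Z.
    apply: (@le_trans _ _ ((1 + c ^+ 2) * (1 + c / 2 + c ^+ 2) *
              ((1 - e) * J / Num.sqrt al))); last first.
      by rewrite ler_wpM2l// mulr_ge0 ?addr_ge0 ?sqr_ge0 ?divr_ge0// ltW.
    rewrite sqrtrM ?(ltW al0)// invfM.
    rewrite [leRHS](_ : _ = ((1 + c ^+ 2) * (1 - e)) * ((1 + c / 2 + c ^+ 2))
        * (J / Num.sqrt al)); last by ring.
    rewrite [leLHS](_ : _ = ((1 + e) * (Num.sqrt (1 - c))^-1)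
        * (J / Num.sqrt al)); last by ring.
    rewrite ler_pM2r ?divr_gt0//; apply: ler_pM.
    + by rewrite addr_ge0// ltW.
    + by rewrite invr_ge0 ltW.
    + by rewrite -ler_pdivrMr.
    + by apply: inv_sqrt1B_le => //; exact: ltW.
  rewrite ler_pdivrMr// -(ler_pM2l c0).
  have := le_trans HM ubE.
  rewrite -lerBrDr -(ler_pM2l (_ : 0 < 2 * s2)) ?mulr_gt0// => {}HM.
  rewrite [leLHS](_ : _ = 2 * s2 * (al * c * M)); last by ring.
  apply: le_trans HM _.
  rewrite [leRHS](_ : _ = 2 * s2 * (c * (1 + 6%:R * c) / 2 * Z)); last by field.
  rewrite ler_pM2l ?mulr_gt0//.
  rewrite -subr_ge0 (_ : _ - _ = Z * (c * (1 + 6%:R * c) / 2 + 1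
     - (1 + c ^+ 2) * (1 + c / 2 + c ^+ 2))); last by ring.
  rewrite mulr_ge0 ?(ltW Z0)//.
  rewrite (_ : _ - _ = c ^+ 2 * (1 - c / 2 - c ^+ 2)); last by field.
  by rewrite mulr_ge0 ?sqr_ge0//; nra.
(* Weights and exponential combine into a Gaussian form with a = r0 and this b; then 1 - (k + 1) b /
   a = 1 / (1 + l), which leaves the power k of 1 + l. *)
- pose b := al * l / k.+1%:R.
  have kb : k.+1%:R * b = al * l by rewrite mulrC divfK// pnatr_eq0.
  have b0 : 0 <= b by rewrite divr_ge0// mulr_ge0// ltW.
  have kbr : k.+1%:R * b < r0.
    by rewrite kb r0E mulrDr mulr1 ltrDr.
  have eJ : 0 <= (1 + e) * J by rewrite mulr_ge0 ?addr_ge0// ltW.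
  have := gauss_form_sum Hz eJ r00 (lexx _) b0 kbr.
  rewrite kb {2 3}r0E -/(al * l).
  set T := \sum_u _ => HT.
  rewrite [leLHS](_ : _ = T / Z ^+ k.+1); last first.
    rewrite /T mulr_suml; apply: eq_bigr => u _.
    rewrite big_split /= prodfV prodr_const card_ord -expR_sum.
    rewrite [LHS]mulrAC -expRD; congr (expR _ / _).
    under [\sum_j (h * _) ^+ 2]eq_bigr do rewrite exprMn.
    rewrite -!mulr_sumr exprMn h2 sumrN -mulr_sumr r0E /b.
    have : (k.+1%:R : R) != 0 by rewrite pnatr_eq0.
    move: (k.+1%:R : R) => kk kk0.
    by field; rewrite kk0 gt_eqF.
  have zk : 0 < Z ^+ k.+1 by rewrite exprn_gt0.
  rewrite ler_pdivrMr//.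
  apply: le_trans HT _.
  have -> : (al * (1 + l)) ^+ k.+1 * (1 - al * l / (al * (1 + l)))
      = al ^+ k.+1 * (1 + l) ^+ k.
    rewrite exprMn [(1 + l) ^+ k.+1]exprSr.
    by move: (al ^+ _) ((1 + l) ^+ _) => x y; field; rewrite !gt_eqF.
  rewrite sqrtrM ?exprn_ge0 ?(ltW al0)//.
  have -> : Num.sqrt (al ^+ k.+1) = Num.sqrt al ^+ k.+1.
    apply/eqP; rewrite -(eqrXn2 (_ : 0 < 2)%N) ?sqrtr_ge0 ?exprn_ge0 ?sqrtr_ge0//.
    by rewrite -exprM mulnC exprM !sqr_sqrtr ?exprn_ge0 // ltW.
  rewrite invfM mulrA [leRHS]mulrAC.
  rewrite ler_wpM2r ?invr_ge0 ?sqrtr_ge0// -expr_div_n -exprMn.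
  apply: lerXn2r; rewrite ?nnegrE.
  + by rewrite divr_ge0// ltW.
  + by rewrite mulr_ge0 ?(ltW Z0)// addr_ge0 ?sqr_ge0.
  apply: (@le_trans _ _ ((1 + c ^+ 2) * ((1 - e) * J / Num.sqrt al))).
    rewrite !mulrA ler_pM2r ?invr_gt0// ler_pM2r//.
    by rewrite -ler_pdivrMr.
  by rewrite ler_wpM2l// addr_ge0 ?sqr_ge0.
Qed.

(** * Random codes *)

Lemma sum_prod_ffun_single (R : comNzRingType) (I V : finType) (p g : V -> R)
    (i0 : I) : \sum_x p x = 1 ->
  \sum_(F : {ffun I -> V}) (\prod_i p (F i)) * g (F i0) = \sum_x p x * g x.
Proof.
move=> p1.
have : \prod_i \sum_x p x * (if i == i0 then g x else 1)
    = \sum_(F : {ffun I -> V}) \prod_i (p (F i) * (if i == i0 then g (F i) else 1)).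
  exact: bigA_distr_bigA.
rewrite (bigD1 i0) //= [X in _ * X]big1 ?mulr1 => [|i /negPf ii0]; last first.
  by rewrite -[RHS]p1; apply: eq_bigr => x _; rewrite ii0 mulr1.
under eq_bigr do rewrite eqxx.
move=> ->; apply: eq_bigr => F _; rewrite big_split /=; congr (_ * _).
by rewrite -big_mkcond big_pred1_eq.
Qed.

(** Coordinates picked by an injective t are again independent with law p: the sum over a fibre
    factors over I, and each coordinate outside the image of t contributes 1. *)
Lemma sum_prod_ffun_inj (R : comNzRingType) (I J V : finType) (p : V -> R)
    (t : J -> I) (G : {ffun J -> V} -> R) :
  \sum_x p x = 1 -> injective t ->
  \sum_(F : {ffun I -> V}) (\prod_i p (F i)) * G [ffun j => F (t j)]
    = \sum_(g : {ffun J -> V}) (\prod_j p (g j)) * G g.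
Proof.
move=> p1 tI.
rewrite (partition_big (fun F : {ffun I -> V} => [ffun j => F (t j)]) xpredT) //=.
apply: eq_bigr => g _.
rewrite (eq_bigr (fun F : {ffun I -> V} => (\prod_i p (F i)) * G g)); last first.
  by move=> F /eqP ->.
rewrite -mulr_suml; congr (_ * _).
pose Q i := [pred x : V | [forall j, (t j == i) ==> (x == g j)]].
rewrite (eq_bigl (fun F : {ffun I -> V} => F \in family Q)); last first.
  move=> F; apply/eqP/familyP => [gE i|FQ].
    by apply/forallP => j; apply/implyP => /eqP <-; rewrite -gE ffunE.
  apply/ffunP => j; rewrite ffunE.
  by have /forallP/(_ j) := FQ (t j); rewrite eqxx => /eqP.
rewrite -(bigA_distr_big_dep _ (fun i x => p x)).
rewrite (bigID (mem (t @: J))) /= [X in _ * X]big1 ?mulr1 => [|i it]; last first.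
  rewrite -[RHS]p1; apply: eq_bigl => x; apply/forallP => j.
  by apply/implyP => /eqP ti; rewrite -ti imset_f in it.
rewrite big_imset /=; last by move=> x y _ _; exact: tI.
apply: eq_bigr => j _; rewrite (big_pred1 (g j)) // => x.
apply/forallP/eqP => [/(_ j)|-> j']; first by rewrite eqxx => /eqP.
by apply/implyP => /eqP/tI ->.
Qed.

Lemma exists_le_mean (R : realFieldType) (T : finType) (p X : T -> R) (b : R) :
  (forall x, 0 <= p x) -> \sum_x p x = 1 -> \sum_x p x * X x <= b ->
  exists x, X x <= b.
Proof.
move=> p0 p1 Xb; apply: contrapT => /forallNP nX.
have [x px] : exists x, p x != 0.
  apply: contrapT => /forallNP p00; move: p1; rewrite big1.
    by move/esym/eqP; rewrite oner_eq0.
  by move=> x _; apply/eqP/negPn/negP; exact: p00.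
have gtb y : b < X y by rewrite ltNge; apply/negP; exact: nX.
have : \sum_y p y * b < \sum_y p y * X y.
  rewrite (bigD1 x)// [ltRHS](bigD1 x)//=; apply: ltr_leD.
    by rewrite ltr_pM2l// lt_neqAle p0 eq_sym px.
  by apply: ler_sum => y _; rewrite ler_wpM2l// ltW.
by rewrite -mulr_suml p1 mul1r ltNge Xb.
Qed.

(* Alteration method: the expected number of deletions is at most
   x M + q M^(k+1). *)
Lemma expurgation (R : realFieldType) (V : finType) (p : V -> R)
    (good : pred V) (k M : nat) (bad : pred {ffun 'I_k.+1 -> V}) (x q : R) :
  (forall y, 0 <= p y) -> \sum_y p y = 1 ->
  \sum_(y | ~~ good y) p y <= x ->
  \sum_(g | bad g) \prod_j p (g j) <= q ->
  exists (F : {ffun 'I_M -> V}) (S : {set 'I_M}),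
    [/\ (1 - x) * M%:R - M%:R ^+ k.+1 * q <= #|S|%:R,
        forall i, i \in S -> good (F i) &
        forall t : {ffun 'I_k.+1 -> 'I_M}, injective t ->
          (forall j, t j \in S) -> ~~ bad [ffun j => F (t j)]].
Proof.
move=> p0 p1 px pq.
(* The number of codewords that are not good plus the number of bad tuples, an upper bound on the
   deletions. *)
pose D (F : {ffun 'I_M -> V}) : R := \sum_i (~~ good (F i))%:R
  + \sum_(t : {ffun 'I_k.+1 -> 'I_M} | injectiveb t) (bad [ffun j => F (t j)])%:R.
have q0 : 0 <= q.
  by apply: le_trans pq; apply: sumr_ge0 => g _; apply: prodr_ge0.
have [F FD] : exists F, D F <= M%:R * x + M%:R ^+ k.+1 * q.
  apply: (@exists_le_mean _ _ (fun F : {ffun 'I_M -> V} => \prod_i p (F i))).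
  - by move=> F; apply: prodr_ge0.
  - by rewrite -(bigA_distr_bigA (fun _ y => p y)) big1.
  under eq_bigr do rewrite mulrDr !mulr_sumr.
  rewrite big_split /=; apply: lerD; rewrite exchange_big /=.
    rewrite (eq_bigr (fun=> \sum_(y | ~~ good y) p y)).
      rewrite sumr_const card_ord -[leLHS]mulr_natl ler_wpM2l//.
    move=> i _; rewrite (sum_prod_ffun_single (fun y => (~~ good y)%:R))//.
    rewrite [RHS]big_mkcond; apply: eq_bigr => y _.
    by case: ifP; rewrite ?mulr1 ?mulr0.
  apply: (@le_trans _ _ (\sum_(t : {ffun 'I_k.+1 -> 'I_M} | injectiveb t) q)).
    apply: ler_sum => t /injectiveP tI.
    rewrite (sum_prod_ffun_inj (fun g => (bad g)%:R) p1 tI).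
    apply: le_trans pq; rewrite [leRHS]big_mkcond; apply: ler_sum => g _.
    by case: ifP; rewrite ?mulr1 ?mulr0.
  rewrite sumr_const -[leLHS]mulr_natl ler_wpM2r// -natrX ler_nat.
  by apply: leq_trans (max_card _) _; rewrite card_ffun !card_ord.
pose B1 := [set i | ~~ good (F i)]%SET.
pose T := [set t : {ffun 'I_k.+1 -> 'I_M} |
            injectiveb t && bad [ffun j => F (t j)]]%SET.
(* Deleting the entry at index 0 is enough to destroy a bad tuple. *)
pose B2 := [set (t : {ffun 'I_k.+1 -> 'I_M}) ord0 | t in T]%SET.
exists F, (~: (B1 :|: B2))%SET; split.
- have DE : D F = (#|B1| + #|T|)%:R.
    rewrite /D natrD; congr (_ + _).
      rewrite -natr_sum -sum1_card big_mkcond /=; congr _%:R.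
      by rewrite [RHS]big_mkcond; apply: eq_bigr => i _; rewrite inE; case: (good _).
    rewrite -natr_sum -sum1_card; congr _%:R.
    rewrite big_mkcond [RHS]big_mkcond; apply: eq_bigr => t _; rewrite inE.
    by case: (injectiveb _) => //=; case: (bad _).
  have : (M <= #|(~: (B1 :|: B2))%SET| + (#|B1| + #|T|))%N.
    rewrite -[X in (X <= _)%N]card_ord -(cardsC (B1 :|: B2)%SET) addnC leq_add2l.
    apply: leq_trans (leq_card_setU _ _) _.
    by rewrite leq_add2l leq_imset_card.
  rewrite -(ler_nat R) natrD -DE.
  by move: FD; set a := D F; set b := _ ^+ _ * q; lra.
- by move=> i; rewrite !inE negb_or negbK => /andP[].
move=> t tI tS; apply/negP => bt.
have := tS ord0; rewrite !inE negb_or => /andP[_ /negP]; apply.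
by apply/imsetP; exists t => //; rewrite inE bt andbT; apply/injectiveP.
Qed.

(** Written this way the radius is a sum of one quadratic form per coordinate, so its exponential
    moment factors over the coordinates. *)
Lemma avg_rad2E (R : realType) (n L : nat) (x : 'I_L -> 'rV[R]_n) :
  (0 < L)%N ->
  avg_rad2 x = L%:R^-1 *
    \sum_(c < n) (\sum_j x j 0 c ^+ 2 - (\sum_j x j 0 c) ^+ 2 / L%:R).
Proof.
move=> L0; rewrite /avg_rad2 /sqnorm; congr (_ * _).
rewrite exchange_big /=; apply: eq_bigr => c _.
have LE : (L%:R : R) != 0 by rewrite pnatr_eq0 -lt0n.
set S := \sum_j x j 0 c.
have xc : centroid x 0 c = S / L%:R.
  by rewrite /centroid mxE summxE mulrC.
rewrite (eq_bigr (fun j => x j 0 c ^+ 2 - (x j 0 c) * (S / L%:R *+ 2)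
   + (S / L%:R) ^+ 2)); last first.
  by move=> j _; rewrite mxE [(- centroid x) 0 c]mxE xc sqrrB mulrnAr.
rewrite big_split /= sumrB sumr_const card_ord -mulr_suml -/S.
rewrite -[_ *+ L]mulr_natr mulr2n.
by field.
Qed.

(** b bounds the Chernoff factor of one coordinate, so b ^ n bounds the probability of a bad tuple.
    The factor k on the right pays for repeated codewords. *)
Lemma random_code (R : realType) (A : finType) (w v : A -> R) (P N t b : R)
    (n M k : nat) :
  (forall a, 0 <= w a) -> \sum_a w a = 1 -> 0 < P -> 0 <= N -> 0 <= t ->
  (0 < n)%N ->
  expR (t * (k.+1%:R * N)) *
   (\sum_(u : {ffun 'I_k.+1 -> A}) (\prod_j w (u j)) *
     expR (- (t * (\sum_j v (u j) ^+ 2 - (\sum_j v (u j)) ^+ 2 / k.+1%:R)))) <= b ->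
  exists C : seq 'rV[R]_n, avg_rad_list_decodable k P N C /\
    (1 - (\sum_a w a * v a ^+ 2) / P) * M%:R - M%:R ^+ k.+1 * b ^+ n
      <= k%:R * (size C)%:R.
Proof.
move=> w0 w1 P0 N0 t0 n0 hb.
pose V : finType := {ffun 'I_n -> A}.
pose p (y : V) := \prod_c w (y c).
have p0 y : 0 <= p y by apply: prodr_ge0.
have p1 : \sum_y p y = 1 by rewrite -(bigA_distr_bigA (fun _ a => w a)) big1.
have nP0 : 0 < n%:R * P by rewrite mulr_gt0// ltr0n.
pose good (y : V) := \sum_c v (y c) ^+ 2 <= n%:R * P.
pose phi (u : 'I_k.+1 -> A) :=
  \sum_j v (u j) ^+ 2 - (\sum_j v (u j)) ^+ 2 / k.+1%:R.
pose bad (g : {ffun 'I_k.+1 -> V}) :=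
  \sum_c phi (fun j => g j c) <= n%:R * (k.+1%:R * N).
(* Markov's inequality for the energy of a codeword. *)
have Hgood : \sum_(y | ~~ good y) p y <= (\sum_a w a * v a ^+ 2) / P.
  apply: (@le_trans _ _ (\sum_y p y * ((\sum_c v (y c) ^+ 2) / (n%:R * P)))).
    rewrite [leLHS]big_mkcond; apply: ler_sum => y _; case: ifP => [|_].
      rewrite -ltNge => /ltW gy; rewrite ler_peMr// ler_pdivlMr// mul1r//.
    by rewrite mulr_ge0// divr_ge0 ?(ltW nP0)// sumr_ge0// => c _; rewrite sqr_ge0.
  under eq_bigr do rewrite mulrA mulr_sumr.
  rewrite -mulr_suml exchange_big /=.
  rewrite (eq_bigr (fun=> \sum_a w a * v a ^+ 2)); last first.
    by move=> c _; rewrite (sum_prod_ffun_single (fun a => v a ^+ 2)).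
  rewrite sumr_const card_ord -[X in X / _]mulr_natl invfM mulrACA divff ?mul1r//.
  by rewrite pnatr_eq0 -lt0n.
(* Chernoff: the indicator of a bad tuple is at most exp (t (n (k + 1) N - sum phi)). *)
have Hbad : \sum_(g | bad g) \prod_j p (g j) <= b ^+ n.
  apply: (@le_trans _ _ (\sum_(g : {ffun 'I_k.+1 -> V}) \prod_c
      (expR (t * (k.+1%:R * N)) * ((\prod_j w (g j c)) *
        expR (- (t * phi (fun j => g j c))))))).
    rewrite [leLHS]big_mkcond; apply: ler_sum => g _; case: ifP => [bg|_]; last first.
      apply: prodr_ge0 => c _; rewrite !mulr_ge0 ?expR_ge0//.
      by apply: prodr_ge0.
    rewrite exchange_big /= !big_split /= prodr_const card_ord -expRM_natl.
    rewrite mulrCA -[leLHS]mulr1; apply: ler_wpM2l.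
      by apply: prodr_ge0 => c _; apply: prodr_ge0.
    rewrite -expR_sum -expRD -[leLHS]expR0 ler_expR sumrN -mulr_sumr.
    rewrite mulrCA -mulrBr.
    by rewrite mulr_ge0// subr_ge0.
  (* Transposition: a tuple of words is read as a word of tuples, whose letters are independent. *)
  rewrite (reindex (fun g : {ffun 'I_n -> {ffun 'I_k.+1 -> A}} =>
     [ffun j => [ffun c => g c j]] : {ffun 'I_k.+1 -> V})) /=; last first.
    exists (fun g : {ffun 'I_k.+1 -> V} => [ffun c => [ffun j => g j c]]) => g _;
      by apply/ffunP => i; apply/ffunP => j; rewrite !ffunE.
  rewrite (eq_bigr (fun g : {ffun 'I_n -> {ffun 'I_k.+1 -> A}} =>
      \prod_c (expR (t * (k.+1%:R * N)) * ((\prod_j w (g c j)) *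
        expR (- (t * phi (g c))))))); last first.
    move=> g _; apply: eq_bigr => c _; congr (_ * (_ * expR (- (_ * _)))).
      by apply: eq_bigr => j _; rewrite !ffunE.
    by rewrite /phi; congr (_ - _ ^+ 2 / _); apply: eq_bigr => j _; rewrite !ffunE.
  rewrite -(bigA_distr_bigA (fun (c : 'I_n) (u : {ffun 'I_k.+1 -> A}) => expR (t * (k.+1%:R * N)) *
      ((\prod_j w (u j)) * expR (- (t * phi u))))).
  rewrite prodr_const card_ord; apply: lerXn2r => //; rewrite ?nnegrE.
  - apply: sumr_ge0 => u _; rewrite !mulr_ge0 ?expR_ge0//.
    by apply: prodr_ge0.
  - apply: le_trans hb; rewrite mulr_ge0 ?expR_ge0// sumr_ge0// => u _.
    by rewrite mulr_ge0 ?expR_ge0//; apply: prodr_ge0.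
  - by rewrite -mulr_sumr.
have [F [S [cS goodS badS]]] := @expurgation _ _ _ good k M bad _ _ p0 p1 Hgood Hbad.
pose x (i : 'I_M) : 'rV[R]_n := \row_c v (F i c).
have radP (s : 'I_k.+1 -> 'I_M) : injective s -> (forall j, s j \in S) ->
    n%:R * N < avg_rad2 (fun j => x (s j)).
  move=> sI sS; have := badS [ffun j => s j].
  have sI' : injective [ffun j => s j] by move=> i j; rewrite !ffunE => /sI.
  have sS' j : [ffun j => s j] j \in S by rewrite ffunE.
  move=> /(_ sI' sS'); rewrite /bad -ltNge avg_rad2E// => lt1.
  rewrite ltr_pdivlMl ?ltr0n// mulrCA.
  apply: lt_le_trans lt1 _; rewrite le_eqVlt; apply/orP; left; apply/eqP.
  apply: eq_bigr => c _; rewrite /phi.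
  congr (_ - _ ^+ 2 / _); apply: eq_bigr => j _; rewrite mxE !ffunE//.
pose C := undup [seq x i | i <- enum S].
have memC y : y \in C -> exists2 i, i \in S & y = x i.
  by rewrite mem_undup => /mapP[i]; rewrite mem_enum => iS ->; exists i.
exists C; split.
  split; first exact: undup_uniq.
  split.
    move=> y /memC[i iS ->]; rewrite /in_ball ler_wsqrtr//.
    apply: le_trans (goodS _ iS); rewrite /sqnorm.
    by apply: ler_sum => c _; rewrite mxE.
  move=> f fI fC.
  have /choice[s sP] j : exists i, i \in S /\ f j = x i.
    by have [i iS ->] := memC _ (fC j); exists i.
  have -> : f = fun j => x (s j) by apply/funext => j; exact: (sP j).2.
  apply: radP => [i j sij|j]; last exact: (sP j).1.
  by apply: fI; rewrite (sP i).2 (sP j).2 sij.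
apply: le_trans cS _; rewrite -natrM ler_nat.
(* Otherwise k + 1 indices in S carry the same word: a surviving tuple of radius 0, contradicting 0
   <= n N < radius. *)
have mult y : (#|[set i in S | x i == y]%SET| <= k)%N.
  rewrite leqNgt; apply/negP => ky.
  pose s (j : 'I_k.+1) : 'I_M := enum_val (widen_ord ky j).
  have sP j : (s j \in S) && (x (s j) == y).
    by have := enum_valP (widen_ord ky j); rewrite inE.
  have : n%:R * N < avg_rad2 (fun j => x (s j)).
    apply: radP => [i j /enum_val_inj ij|j]; last by have /andP[] := sP j.
    by apply/val_inj; have := congr1 val ij.
  have -> : (fun j => x (s j)) = fun=> y.
    by apply/funext => j; have /andP[_ /eqP] := sP j.
  rewrite avg_rad2E// big1 ?mulr0 ?ltNge ?mulr_ge0// => c _.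
  rewrite !sumr_const card_ord -[y 0 c *+ _]mulr_natr -[_ *+ k.+1]mulr_natr.
  have : (k.+1%:R : R) != 0 by rewrite pnatr_eq0.
  by move: (k.+1%:R : R) => K K0; field.
apply: (@leq_trans (\sum_(i in S) \sum_(y <- C) (x i == y))).
  rewrite -sum1_card; apply: leq_sum => i iS.
  have xC : x i \in C by rewrite mem_undup map_f// mem_enum.
  by rewrite (big_rem _ xC) /= eqxx.
rewrite exchange_big /=.
apply: (@leq_trans (\sum_(y <- C) k)).
  apply: leq_sum => y _; apply: leq_trans (mult y).
  rewrite -sum1_card big_mkcond [leqRHS]big_mkcond.
  apply: leq_sum => i _; rewrite inE.
  by case: (i \in S) => //=; case: eqP.
by rewrite big_const_seq count_predT iter_addn_0.
Qed.

(** * Asymptotics *)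

(** The limsup is an infimum of suprema over neighbourhoods of infinity, and each of these contains
    all lengths from some n0 on. *)
Lemma list_capacity_ge (R : realType) (k : nat) (P N r : R) :
  (forall e : R, 0 < e -> forall n0 : nat, exists2 n, (n0 <= n)%N &
    exists2 C : seq 'rV[R]_n, avg_rad_list_decodable k P N C & r - e <= rate C) ->
  (r%:E <= list_capacity k P N)%E.
Proof.
move=> H; apply/ereal_infP => _ [S [n0 _ n0S] <-].
apply/lee_addgt0Pr => e e0.
have [n n0n [C CD Cr]] := H e e0 n0.
apply: (@le_trans _ _ (rate C + e)%:E); first by rewrite lee_fin -lerBlDr.
rewrite EFinD leeD2r//.
apply: (@le_trans _ _ (ereal_sup [set ((rate C)%:E)%E |
   C in [set C : seq 'rV[R]_n | avg_rad_list_decodable k P N C]])).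
  by apply: ereal_sup_ubound; exists C.
by apply: ereal_sup_ubound; exists n => //; exact: n0S.
Qed.

Lemma list_capacity_ge0 (R : realType) (k : nat) (P N : R) :
  (0%:E <= list_capacity k P N)%E.
Proof.
(* The empty code is decodable vacuously, and has rate 0 because [ln] is 0 at 0. *)
apply: list_capacity_ge => e e0 n0; exists n0 => //; exists [::].
  by split=> //; split=> // f _ /(_ ord0); rewrite in_nil.
by rewrite /rate /= ln0// mul0r sub0r oppr_le0 ltW.
Qed.

(** Any loss e in the rate pays for the constants: for large n, half of c exp (n r) outweighs d and
    the other half is at least exp (n (r - e)). *)
Lemma list_capacity_ge_exp (R : realType) (k : nat) (P N r c d : R) :
  0 < c -> 0 < r ->
  (forall n, (0 < n)%N -> exists2 C : seq 'rV[R]_n,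
    avg_rad_list_decodable k P N C & c * expR (n%:R * r) - d <= (size C)%:R) ->
  (r%:E <= list_capacity k P N)%E.
Proof.
move=> c0 r0 HC; apply: list_capacity_ge => e e0 n0.
have c20 : 0 < c / 2 by rewrite divr_gt0.
pose n1 := (Num.truncn (d / (c / 2) / r)).+1.
pose n2 := (Num.truncn ((c / 2)^-1 / e)).+1.
pose n := (n0 + n1 + n2)%N.
have n_gt0 : (0 < n)%N by rewrite /n /n2 addnS.
exists n; first by rewrite /n -addnA leq_addr.
have [C CD CS] := HC n n_gt0; exists C => //.
have expx (x : R) : x <= expR x.
  by apply: le_trans (expR_ge1Dx x); rewrite lerDr.
have big1 : d <= c / 2 * expR (n%:R * r).
  rewrite mulrC -ler_pdivrMr//; apply: le_trans (expx _).
  rewrite -ler_pdivrMr//; apply: le_trans (ltW (truncnS_gt _)) _.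
  by rewrite ler_nat /n -/n1 addnAC leq_addl.
have big2 : 1 <= c / 2 * expR (n%:R * e).
  rewrite mulrC -ler_pdivrMr// mul1r; apply: le_trans (expx _).
  rewrite -ler_pdivrMr//; apply: le_trans (ltW (truncnS_gt _)) _.
  by rewrite ler_nat /n -/n2 leq_addl.
have big : expR (n%:R * (r - e)) <= (size C)%:R.
  apply: le_trans CS; rewrite mulrBr expRD expRN.
  rewrite ler_pdivrMr ?expR_gt0// mulrBl.
  have e1 : 1 <= expR (n%:R * e) by rewrite -[leLHS]expR0 ler_expR mulr_ge0// ltW.
  move: big1 big2 e1 (expR_ge0 (n%:R * r)).
  set x := expR _; set y := expR _ => h1 h2 h3 h4.
  have h5 : d * y <= c / 2 * x * y by rewrite ler_wpM2r// (le_trans ler01).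
  have h6 : x <= c / 2 * y * x by rewrite ler_peMl.
  rewrite lerBrDr; apply: le_trans (lerD h6 h5) _.
  by rewrite le_eqVlt; apply/orP; left; apply/eqP; field.
rewrite /rate ler_pdivlMr ?ltr0n// mulrC -[leLHS]expRK ler_ln ?posrE ?expR_gt0//.
exact: lt_le_trans (expR_gt0 _) big.
Qed.

Lemma gaussian_code_exponent (R : realType) (P N c : R) (k : nat) :
  0 < P -> 0 < N -> (0 < k)%N -> 0 < c -> c <= 2^-1 ->
  let d := (k.+1%:R * N) / (k%:R * P) in
  d <= 1 -> forall n, (0 < n)%N -> forall M : nat,
  exists2 C : seq 'rV[R]_n, avg_rad_list_decodable k P N C &
    c / (1 + 7%:R * c) * M%:R - M%:R ^+ k.+1 *
      expR (- (k%:R * (2^-1 * (ln d^-1 + d - 1) - 5%:R * c))) ^+ n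
      <= k%:R * (size C)%:R.
Proof.
move=> P0 N0 k0 c0 c1 d d1 n n0 M.
have k0R : 0 < k%:R :> R by rewrite ltr0n.
have d0 : 0 < d by rewrite divr_gt0// mulr_gt0// ltr0n.
have c7 : 0 < 1 + 7%:R * c by rewrite addr_gt0// mulr_gt0.
(* The second moment is at most s2 (1 + 6 c), so Markov's inequality leaves the fraction c / (1 + 7
   c) of the codewords. *)
pose s2 := P / (1 + 7%:R * c).
have s20 : 0 < s2 by rewrite divr_gt0.
(* For s2 = P this l minimizes the Chernoff exponent l (k + 1) N / (2 P) - (k / 2) ln (1 + l). *)
pose l := d^-1 - 1.
have l0 : 0 <= l by rewrite subr_ge0 invf_ge1.
have [A [w [v [w0 w1 wv Hsum]]]] := gaussian_alphabet k s20 c0 c1 l0.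
pose t := l / (2 * s2).
have t0 : 0 <= t by rewrite divr_ge0// mulr_ge0// ltW.
have l1 : 1 + l = d^-1 by rewrite /l addrC subrK.
have tE : t * (k.+1%:R * N) = k%:R * ((1 - d) * (1 + 7%:R * c) / 2).
  have -> : k.+1%:R * N = d * (k%:R * P).
    by rewrite /d divfK// mulf_neq0 ?gt_eqF.
  by rewrite /t /s2 /l; field; rewrite !gt_eqF.
have sqrtE : (Num.sqrt ((1 + l) ^+ k))^-1 = expR (k%:R * (- (ln d^-1 / 2))).
  have -> : (1 + l) ^+ k = expR (k%:R * (ln d^-1 / 2)) ^+ 2.
    rewrite l1 -expRM_natl -{1}[d^-1]lnK ?posrE ?invr_gt0// -expRM_natl.
    by congr expR; field.
  by rewrite sqrtr_sqr ger0_norm ?expR_ge0// mulrN expRN.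
(* As k >= 1, the bound k + 1 <= 2 k makes this loss proportional to k, like the exponent. *)
have cexp : (1 + c ^+ 2) ^+ k.+1 <= expR (k%:R * c).
  apply: (@le_trans _ _ (expR (c ^+ 2) ^+ k.+1)).
    by apply: lerXn2r; rewrite ?nnegrE ?expR_ge0 ?expR_ge1Dx// addr_ge0// sqr_ge0.
  rewrite -expRM_natl ler_expR.
  have k2 : k.+1%:R <= 2 * k%:R :> R.
    by rewrite -natrM ler_nat mul2n -addnn -addn1 leq_add2l.
  apply: (@le_trans _ _ (2 * k%:R * c ^+ 2)); first by rewrite ler_wpM2r// sqr_ge0.
  rewrite (_ : 2 * _ * _ = k%:R * (2 * c ^+ 2)); last by ring.
  by apply: ler_wpM2l; [exact: ltW|nra].
have hb := @random_code _ A w v P N t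
  (expR (- (k%:R * (2^-1 * (ln d^-1 + d - 1) - 5%:R * c)))) n M k
  w0 w1 P0 (ltW N0) t0 n0.
have [|C [CD CS]] := hb.
  apply: le_trans (ler_wpM2l (expR_ge0 _) Hsum) _.
  rewrite sqrtE mulrCA.
  apply: le_trans (ler_wpM2r _ cexp) _.
    by rewrite mulr_ge0// expR_ge0.
  (* Per unit of k the loss is 7 c (1 - d) / 2 from s2 < P and c from [cexp], together below 5 c. *)
  rewrite -!expRD ler_expR tE -!mulrDr -[leRHS]mulrN ler_pM2l//.
  by nra.
exists C => //; apply: le_trans CS.
rewrite lerD2r ler_wpM2r//.
have : (\sum_a w a * v a ^+ 2) / P <= (1 + 6%:R * c) / (1 + 7%:R * c).
  rewrite ler_pdivrMr//; apply: le_trans wv _.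
  by rewrite /s2 le_eqVlt; apply/orP; left; apply/eqP; ring.
move=> h.
rewrite (_ : c / _ = 1 - (1 + 6%:R * c) / (1 + 7%:R * c)); last first.
  by field; rewrite gt_eqF.
by move: h; lra.
Qed.

Theorem mainTheorem5 (R : realType) (P N : R) (L : nat) :
  0 < P -> 0 < N -> (2 <= L)%N ->
  N / P <= (L%:R - 1) / L%:R ->
  ((2^-1 * (ln (((L%:R - 1) * P) / (L%:R * N))
             + (L%:R * N) / ((L%:R - 1) * P) - 1))%:E
   <= list_capacity (L.-1) P N)%E.
Proof.
move=> P0 N0; case: L => [//|k]; rewrite ltnS /= => k0.
have k0R : 0 < k%:R :> R by rewrite ltr0n.
have kE : k.+1%:R - 1 = k%:R :> R by rewrite -natr1 addrK.
rewrite kE => NP.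
rewrite -[k%:R * P / _]invf_div.
pose d := k.+1%:R * N / (k%:R * P); rewrite -/d.
have d1 : d <= 1.
  rewrite ler_pdivrMr ?mulr_gt0// mul1r mulrC.
  by move: NP; rewrite ler_pdivrMr// mulrAC ler_pdivlMr ?ltr0n.
set T := 2^-1 * _.
apply/lee_addgt0Pr => e e0.
pose c := Num.min 2^-1 (e / 5%:R).
have c0 : 0 < c by rewrite lt_min !divr_gt0// invr_gt0 ltr0n.
have c1 : c <= 2^-1 by rewrite ge_min lexx.
have ce : 5%:R * c <= e.
  by rewrite mulrC -ler_pdivlMr// ge_min lexx orbT.
apply: (@le_trans _ _ ((T - 5%:R * c)%:E + e%:E)%E).
  by rewrite -EFinD lee_fin; move: ce; lra.
rewrite leeD2r//.
(* A nonpositive exponent is already met by the empty code. *)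
have [r0|r0] := leP (T - 5%:R * c) 0.
  by apply: le_trans (list_capacity_ge0 k P N); rewrite lee_fin.
set r := T - 5%:R * c in r0 *.
pose h := c / (1 + 7%:R * c).
have c7 : 0 < 1 + 7%:R * c by rewrite addr_gt0// mulr_gt0.
have h0 : 0 < h by rewrite divr_gt0.
have h1 : h / 2 <= 1.
  rewrite ler_pdivrMr// mul1r ler_pdivrMr//; lra.
apply: (@list_capacity_ge_exp _ k P N r ((h / 2) ^+ 2 / k%:R) (h / 2 / k%:R)) => //.
  by rewrite !divr_gt0// exprn_gt0 ?divr_gt0.
move=> n n0.
(* With M the integer part of x, the bound M ^ (k + 1) exp (- n k r) on the expected number of bad
   tuples is at most (h / 2) ^ k M <= (h / 2) M, half of the term h M left by the power
   constraint. *)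
pose x := h / 2 * expR (n%:R * r).
have x0 : 0 <= x by rewrite mulr_ge0 ?expR_ge0// divr_ge0// ltW.
pose M := Num.truncn x.
have [C CD CS] := gaussian_code_exponent P0 N0 k0 c0 c1 d1 n0 M.
exists C => //.
rewrite -(ler_pM2l k0R).
apply: le_trans CS; rewrite -/d -/T -/r -/h.
have Mx : M%:R <= x by rewrite truncn_le.
have xM : x <= M%:R + 1 by rewrite natr1 ltW// truncnS_gt.
apply: (@le_trans _ _ (h / 2 * M%:R)).
  rewrite (_ : _ * (_ - _) = h / 2 * (x - 1)); last first.
    by rewrite /x; field; rewrite gt_eqF.
  by rewrite ler_pM2l ?divr_gt0// lerBlDr.
have : M%:R ^+ k.+1 * expR (- (k%:R * r)) ^+ n <= h / 2 * M%:R.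
  rewrite exprS -mulrA mulrC ler_wpM2r//.
  apply: (@le_trans _ _ ((h / 2) ^+ k)); last first.
    by apply: ler_iXnr => //; rewrite divr_ge0// ltW.
  have -> : expR (- (k%:R * r)) ^+ n = (expR (n%:R * r) ^+ k)^-1.
    by rewrite -!expRM_natl -expRN; congr expR; ring.
  rewrite ler_pdivrMr ?exprn_gt0 ?expR_gt0// -exprMn.
  by apply: lerXn2r; rewrite ?nnegrE.
lra.
Qed.
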